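(* Let $T$ be a tree that is not a path. Then $o(T)=\mathcal{S}$ if $|N(v)\cap L_v|\geq 4$ for some $v\in M_2(T)$, or $|N(u)\cap L_u|=3=|N(w)\cap L_w|$ for distinct $u,w\in M_2(T)$; $o(T)=\mathcal{N}$ if $|N(w)\cap L_w|=3$ for exactly one $w\in M_2(T)$ and $|N(v)\cap L_v|\leq 2$ for each $v\in M_2(T)\setminus\{w\}$; and $o(T)=\mathcal{R}$ if $|N(v)\cap L_v|\leq 2$ for each $v\in M_2(T)$. Moreover, if $o(T)=\mathcal{S}$ then $S_{\rm MB}(T)=S'_{\rm MB}(T)=2$, and if $o(T)=\mathcal{R}$ then $R_{\rm MB}(T)=R'_{\rm MB}(T)=\dim(T)=\sigma(T)-ex(T)$.
   Context: In a tree $T$, $N(v)$ is the open neighborhood of $v$. A major vertex is a vertex of degree at least $3$. A degree-one vertex $\ell$ is a terminal vertex of a major vertex $v$ if $d(\ell,v)<d(\ell,w)$ for every other major vertex $w$. The terminal degree $ter(v)$ is the number of terminal vertices of $v$; an exterior major vertex is a major vertex with positive terminal degree. $ex(T)$ is the number of exterior major vertices, $\sigma(T)$ the number of leaves, $M(T)$ the set of exterior major vertices, $M_2(T)=\{w\in M(T): ter(w)\geq 2\}$, and $L_v$ is the set of terminal vertices of $v$. A resolving set is $W\subseteq V(T)$ such that for all distinct $x,y$ some $z\in W$ has $d(x,z)\neq d(y,z)$; $\dim(T)$ is the minimum size of a resolving set. In the Maker-Breaker resolving game, Resolver and Spoiler alternately select (without skipping) a not-yet-selected vertex; Resolver wins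 if at some point his vertices form a resolving set, otherwise Spoiler wins. R-game: Resolver moves first; S-game: Spoiler moves first. $o(T)=\mathcal{R}$ (resp. $\mathcal{S}$) if Resolver (resp. Spoiler) has a winning strategy in both games; $o(T)=\mathcal{N}$ if the first player has a winning strategy in each game. $R_{\rm MB}$, $R'_{\rm MB}$ are the minimum numbers of moves Resolver needs to win the R-game, resp. S-game, and $S_{\rm MB}$, $S'_{\rm MB}$ the minimum numbers of moves Spoiler needs to win the R-game, resp. S-game (each $\infty$ if that player has no winning strategy). *)

(* Defs.v *)
From HB Require Import structures.
From mathcomp Require Import all_boot.
From mathcomp Require Import boolp.

Set Implicit Arguments.
Unset Strict Implicit.
Unset Printing Implicit Defensive.

(* The minimum of a set of natural numbers; None stands for infinity, the
   minimum of the empty set. *)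
Definition least (P : nat -> Prop) : option nat :=
  if pselect (exists n, `[< P n >]) is left h then Some (ex_minn h) else None.

Section Graph.
Variables (T : finType) (e : rel T).

Definition is_tree : Prop :=
  [/\ symmetric e, irreflexive e, 0 < #|T|,
      forall x y, connect e x y
    & forall c : seq T, 2 < size c -> ~ ucycle e c].

Definition is_path_graph : Prop :=
  exists n (f : 'I_n -> T), bijective f /\
    forall i j, e (f i) (f j) = (i.+1 == j) || (j.+1 == i).

(* The length of a shortest walk from x to y; #|T| if there is no walk. *)
Definition dist (x y : T) : nat :=
  find (fun n => [exists p : n.-tuple T, path e x p && (last x p == y)])
       (iota 0 #|T|).

Definition nbh (v : T) : {set T} := [set w | e v w].
Definition deg (v : T) : nat := #|nbh v|.
Definition major (v : T) : bool := 3 <= deg v.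

Definition terminal (l v : T) : bool :=
  [&& deg l == 1, major v &
      [forall w, major w && (w != v) ==> (dist l v < dist l w)]].

Definition term_set (v : T) : {set T} := [set l | terminal l v].
Definition ter (v : T) : nat := #|term_set v|.
Definition ext_major : {set T} := [set v | major v & 0 < ter v].
Definition ext_major2 : {set T} := [set v in ext_major | 2 <= ter v].
Definition ex_num : nat := #|ext_major|.
Definition leaf_num : nat := #|[set l | deg l == 1]|.

Definition resolving (W : {set T}) : bool :=
  [forall x, forall y, (x != y) ==> [exists z in W, dist x z != dist y z]].

Definition metric_dim : nat :=
  #|[arg min_(W < [set: T] | resolving W) #|W| ]|.

End Graph.

Variant player := Resolver | Spoiler.

Definition opponent (pl : player) : player :=
  if pl is Resolver then Spoiler else Resolver.
Definition bool_of_player (pl : player) : bool :=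
  if pl is Resolver then true else false.
Definition player_of_bool (b : bool) : player :=
  if b then Resolver else Spoiler.
Lemma bool_of_playerK : cancel bool_of_player player_of_bool.
Proof. by case. Qed.
HB.instance Definition _ := Equality.copy player (can_type bool_of_playerK).

Variant outcome := OutcomeR | OutcomeS | OutcomeN.

(* A history is the duplicate-free sequence of the vertices selected so far by
   both players, in order.  Play is continued until all vertices have been
   selected; this is harmless, as whether a player has won is read off the
   prefixes of the play. *)
Section Game.
Variables (T : finType) (e : rel T) (first : player).

Definition turn (n : nat) : player := if odd n then opponent first else first.

Definition chosen (pl : player) (h : seq T) : {set T} :=
  [set x in h | turn (index x h) == pl].

Definition strategy := seq T -> T.

Definition legal_strategy (s : strategy) : Prop :=
  forall h, uniq h -> size h < #|T| -> s h \notin h.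

Definition complete_play (p : seq T) : Prop := uniq p /\ size p = #|T|.

Definition follows (pl : player) (s : strategy) (p : seq T) : Prop :=
  forall h x, prefix (rcons h x) p -> turn (size h) = pl -> x = s h.

Definition resolver_wins (p : seq T) : Prop :=
  exists2 h, prefix h p & resolving e (chosen Resolver h).

Definition wins (pl : player) (p : seq T) : Prop :=
  if pl is Resolver then resolver_wins p else ~ resolver_wins p.

Definition has_winning_strategy (pl : player) : Prop :=
  exists2 s, legal_strategy s &
    forall p, complete_play p -> follows pl s p -> wins pl p.

(* Resolver has won once his vertices form a resolving set; Spoiler has won
   once his vertices meet every resolving set, so that Resolver can no longer
   complete one. *)
Definition has_won (pl : player) (h : seq T) : Prop :=
  if pl is Resolver then resolving e (chosen Resolver h)
  else forall W, resolving e W -> ~~ [disjoint W & chosen Spoiler h].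

Definition wins_within (pl : player) (k : nat) : Prop :=
  exists2 s, legal_strategy s &
    forall p, complete_play p -> follows pl s p ->
      exists h, [/\ prefix h p, #|chosen pl h| <= k & has_won pl h].

Definition moves_to_win (pl : player) : option nat := least (wins_within pl).

End Game.

Section Invariants.
Variables (T : finType) (e : rel T).

Definition has_outcome (o : outcome) : Prop :=
  match o with
  | OutcomeR => has_winning_strategy e Resolver Resolver /\
                has_winning_strategy e Spoiler Resolver
  | OutcomeS => has_winning_strategy e Resolver Spoiler /\
                has_winning_strategy e Spoiler Spoiler
  | OutcomeN => has_winning_strategy e Resolver Resolver /\
                has_winning_strategy e Spoiler Spoiler
  end.

(* The R-game is the game with first player Resolver; the primed invariants
   refer to the S-game, with first player Spoiler. *)
Definition R_MB : option nat := moves_to_win e Resolver Resolver.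
Definition R_MB' : option nat := moves_to_win e Spoiler Resolver.
Definition S_MB : option nat := moves_to_win e Resolver Spoiler.
Definition S_MB' : option nat := moves_to_win e Spoiler Spoiler.

End Invariants.

(* Main.v *)
(* In a tree, the neighbours of v on two branches at v which a set W misses
   have the same distance to every vertex of W.  Conversely, two vertices
   which a nonempty W does not distinguish lie in two missed branches at their
   median with a vertex of W.  So W is resolving iff it misses at most one
   branch at each vertex.  A branch without major vertices at a major vertex v
   is a leg, the path from a terminal vertex of v to v without v, and a branch
   with a major vertex contains two legs at a common vertex; hence W is
   resolving iff it misses at most one leg at each major vertex, and the
   metric dimension is the number of leaves minus the number of exterior major
   vertices.

   Let p(v) be the number of leaves adjacent to v.  Any two of them are twins,
   so Spoiler wins by taking two, which he can do once three are free on his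
   move.  Resolver spares one leg at each exterior major vertex, of length one
   if possible, and has to meet the others.  A leg of length at least two has
   two vertices, and one leg of length one at v can be merged with a spared
   leg of length one.  This yields disjoint blocks, one for each leaf that is
   not spared, and the number of those with only one vertex is at most the
   surplus, the sum of the positive parts of p(v) - 2.  Resolver meets a new
   block in every move as long as at most one block is down to its last vertex
   when he moves.  Thus Resolver wins if the surplus is 0, or if it is at most
   1 and he moves first, and Spoiler wins otherwise. *)

Require Import Defs.
From mathcomp Require Import all_boot boolp zify.

Set Implicit Arguments.
Unset Strict Implicit.
Unset Printing Implicit Defensive.

(** * Disjoint families *)

Definition disjoint_family (S T : finType) (I : {set S}) (F : S -> {set T}) :
    Prop :=
  {in I &, forall i j x, x \in F i -> x \in F j -> i = j}.

Definition meets_family (S T : finType) (I : {set S}) (F : S -> {set T})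
    (W : {set T}) : Prop :=
  {in I, forall i, ~~ [disjoint F i & W]}.

Lemma sum_card_setI_le (S T : finType) (I : {set S}) (F : S -> {set T})
    (W : {set T}) :
  disjoint_family I F -> \sum_(i in I) #|F i :&: W| <= #|W|.
Proof.
move=> disF; under eq_bigr do rewrite -sum1_card.
rewrite (exchange_big_dep (mem W)) /= => [|i x _]; last by case/setIP.
rewrite -sum1_card; apply: leq_sum => x _; rewrite sum1_card.
apply/card_le1_eqP => j i /andP[jI /setIP[xj _]] /andP[iI /setIP[xi _]].
exact: (disF i j iI jI x).
Qed.

(** * Plays and strategies *)

Lemma least_eq (P : nat -> Prop) n :
  P n -> (forall m, P m -> n <= m) -> least P = Some n.
Proof.
move=> Pn n_min; rewrite /least; case: pselect => [exP|[]]; last first.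
  by exists n; apply/asboolP.
case: ex_minnP => m /asboolP /n_min n_le m_min; congr Some; apply/eqP.
by rewrite eqn_leq n_le m_min ?asboolT.
Qed.

Section Plays.
Variables (T : finType) (e : rel T) (first : player).
Implicit Types (h p : seq T) (s : strategy T) (pl : player) (x y : T).
Implicit Types (M O W : {set T}).

Local Notation turn := (turn first).
Local Notation chosen := (@chosen T first).

Lemma turnS n : turn n.+1 = opponent (turn n).
Proof. by rewrite /Defs.turn /=; case: odd; case: first. Qed.

Lemma eq_opponentr pl pl' : (pl' == opponent pl) = (pl' != pl).
Proof. by case: pl; case: pl'. Qed.

Lemma eq_opponentl pl pl' : (opponent pl' == pl) = (pl' != pl).
Proof. by case: pl; case: pl'. Qed.

Lemma chosen_nil pl : chosen pl [::] = set0.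
Proof. by apply/setP => x; rewrite !inE. Qed.

Lemma chosen_rcons pl h x : uniq (rcons h x) ->
  chosen pl (rcons h x) =
    if turn (size h) == pl then x |: chosen pl h else chosen pl h.
Proof.
rewrite rcons_uniq => /andP[xh _]; apply/setP => y.
by case: ifP => turn_h; rewrite !inE mem_rcons inE -cats1 index_cat;
  have [->|_] := eqVneq y x; rewrite ?(negbTE xh) /= ?eqxx ?addn0 ?turn_h;
  case: (y \in h).
Qed.

Lemma chosenU pl h : chosen pl h :|: chosen (opponent pl) h = [set x in h].
Proof.
by apply/setP => x; rewrite !inE eq_opponentr -andb_orr orbN andbT.
Qed.

Lemma chosen_prefix pl h p : prefix h p -> chosen pl h \subset chosen pl p.
Proof.
case/prefixP=> t ->; apply/subsetP => x; rewrite !inE mem_cat index_cat.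
by case/andP=> -> ->.
Qed.

Lemma chosen_disjoint h : [disjoint chosen Resolver h & chosen Spoiler h].
Proof.
apply/pred0P => x; apply/negP => /= /andP[].
by rewrite !inE => /andP[_ /eqP->] /andP[].
Qed.

Lemma complete_play_mem p x : complete_play p -> x \in p.
Proof.
case=> /card_uniqP p_card p_size.
have /subset_cardP/(_ (subset_predT _)) -> // : #|p| = #|T|.
by rewrite p_card.
Qed.

Lemma prefix_ind p (P : seq T -> Prop) : P [::] ->
  (forall h x, prefix (rcons h x) p -> P h -> P (rcons h x)) ->
  forall h, prefix h p -> P h.
Proof.
move=> P_nil P_rcons; elim/last_ind => // h x IHh hx_p.
apply: P_rcons => //; apply: IHh.
exact: prefix_trans (prefix_rcons h x) hx_p.
Qed.

Lemma exists_legal_strategy (good : seq T -> T -> Prop) : 0 < #|T| ->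
  exists2 s, legal_strategy s &
    forall h x, x \notin h -> good h x -> good h (s h).
Proof.
case/card_gt0P=> x0 _.
pose s h := if [pick x | (x \notin h) && `[< good h x >]] is Some x then x
            else odflt x0 [pick x | x \notin h].
exists s => [h h_uniq h_size|h x xh good_x]; rewrite /s; last first.
  by case: pickP => [y /andP[_ /asboolP]//|/(_ x)]; rewrite xh asboolT.
case: pickP => [y /andP[]//|_]; case: pickP => //= all_h.
move: h_size; rewrite -(card_uniqP h_uniq) ltnNge; case/negP.
by apply/subset_leq_card/subsetP => x _; move: (all_h x) => /negbFE.
Qed.

Definition play s n : seq T := iter n (fun h => rcons h (s h)) [::].

Lemma size_play s n : size (play s n) = n.
Proof. by elim: n => //= n IHn; rewrite size_rcons IHn. Qed.

Lemma play_follows s n h x : prefix (rcons h x) (play s n) -> x = s h.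
Proof.
elim: n => [|n IHn]; first by case: h.
case/prefixP=> t; case/lastP: t => [|t y] /=.
  by rewrite cats0 => /rcons_inj[<- <-].
rewrite -rcons_cat => /rcons_inj[play_n _].
by apply: IHn; rewrite play_n prefix_prefix.
Qed.

Lemma play_uniq s n : legal_strategy s -> n <= #|T| -> uniq (play s n).
Proof.
move=> s_legal; elim: n => //= n IHn n_lt; have n_uniq := IHn (ltnW n_lt).
by rewrite rcons_uniq n_uniq andbT; apply: s_legal; rewrite ?size_play.
Qed.

Lemma exists_play s s' : legal_strategy s -> legal_strategy s' ->
  exists p, [/\ complete_play p, follows first Resolver s p
              & follows first Spoiler s' p].
Proof.
move=> s_legal s'_legal.
pose s_mix h := if turn (size h) == Resolver then s h else s' h.
have mix_legal : legal_strategy s_mix.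
  by move=> h h_uniq h_size; rewrite /s_mix; case: ifP => _; auto.
exists (play s_mix #|T|); split.
- by split; [exact: play_uniq | exact: size_play].
- by move=> h x /play_follows -> turn_h; rewrite /s_mix turn_h eqxx.
- by move=> h x /play_follows -> turn_h; rewrite /s_mix turn_h.
Qed.

Lemma winning_strategy_exclusive : has_winning_strategy e first Resolver ->
  has_winning_strategy e first Spoiler -> False.
Proof.
move=> [s s_legal s_wins] [s' s'_legal s'_wins].
have [p [p_complete follows_s follows_s']] := exists_play s_legal s'_legal.
exact: s'_wins follows_s' (s_wins _ p_complete follows_s).
Qed.

Lemma wins_within_has_winning_strategy pl k :
  wins_within e first pl k -> has_winning_strategy e first pl.
Proof.
case=> s s_legal s_wins; exists s => // p p_complete p_follows.
have [h [h_p _ won_h]] := s_wins p p_complete p_follows.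
case: pl won_h {s_wins p_follows} => /= won_h; first by exists h.
case=> h' h'_p /won_h /pred0Pn[x /= /andP[xR xS]].
have /pred0P/(_ x) /= := chosen_disjoint p.
by rewrite (subsetP (chosen_prefix _ h'_p)) ?(subsetP (chosen_prefix _ h_p)).
Qed.

Definition winning_set pl W : Prop :=
  if pl is Resolver then resolving e W
  else forall W', resolving e W' -> ~~ [disjoint W' & W].

Lemma has_wonE pl h : has_won e first pl h = winning_set pl (chosen pl h).
Proof. by case: pl. Qed.

Lemma wins_within_winning_set pl k : wins_within e first pl k ->
  exists2 W, winning_set pl W & #|W| <= k.
Proof.
case=> s s_legal s_wins.
have [p [p_complete follows_R follows_S]] := exists_play s_legal s_legal.
have [|h [_ h_k]] := s_wins p p_complete; first by case: pl s_wins.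
by rewrite has_wonE; exists (chosen pl h).
Qed.

Lemma moves_to_win_eq pl k : wins_within e first pl k ->
  (forall W, winning_set pl W -> k <= #|W|) ->
  moves_to_win e first pl = Some k.
Proof.
move=> wins_k k_min; apply: least_eq => // m /wins_within_winning_set[W].
by move/k_min; exact: leq_trans.
Qed.

(* The player owning M, to move against the owner of O, can win in n further
   moves.  The reply y is not required to be a free vertex: this costs nothing
   below, and makes a position on a full board forcing only if it is won. *)
Fixpoint forces pl n M O : Prop :=
  winning_set pl M \/
  (if n is m.+1 then
     exists2 x, x \notin M :|: O & forall y, forces pl m (x |: M) (y |: O)
   else False).

Lemma forces_move pl n M O : forces pl n M O -> ~ winning_set pl M ->
  0 < n /\ exists2 x, x \notin M :|: O &
    forall y, forces pl n.-1 (x |: M) (y |: O).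
Proof. by case: n => [|n] [//|]. Qed.

Definition ahead pl k h : Prop :=
  let M := chosen pl h in let O := chosen (opponent pl) h in
  #|M| <= k /\
  (if turn (size h) == pl then forces pl (k - #|M|) M O
   else forall y, forces pl (k - #|M|) M (y |: O)).

Lemma ahead_nil pl k :
  (forall O, #|O| <= (first != pl) -> forces pl k set0 O) -> ahead pl k [::].
Proof.
move=> forces_start; rewrite /ahead !chosen_nil cards0 subn0; split=> //.
case: eqP forces_start => _ forces_start.
  by apply: forces_start; rewrite cards0.
by move=> y; apply: forces_start; rewrite setU0 cards1.
Qed.

Lemma ahead_opponent_move pl k h x : uniq (rcons h x) -> turn (size h) != pl ->
  ahead pl k h -> ahead pl k (rcons h x).
Proof.
move=> hx_uniq turn_h; rewrite /ahead !chosen_rcons // size_rcons turnS.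
by rewrite eq_opponentr eq_opponentl turn_h (negbTE turn_h) => -[].
Qed.

Lemma ahead_own_move pl k h : uniq h -> turn (size h) = pl -> ahead pl k h ->
  ~ winning_set pl (chosen pl h) ->
  exists2 x, x \notin h & ahead pl k (rcons h x).
Proof.
move=> h_uniq turn_h [h_k]; rewrite turn_h eqxx => h_forces not_won.
have [k_gt [x x_free x_forces]] := forces_move h_forces not_won.
have {x_free} xh : x \notin h by move: x_free; rewrite chosenU inE.
have x_new : x \notin chosen pl h by apply: contra xh; rewrite inE => /andP[].
have hx_uniq : uniq (rcons h x) by rewrite rcons_uniq xh.
exists x => //; rewrite /ahead !chosen_rcons // size_rcons turnS turn_h.
rewrite eq_opponentr eq_opponentl eqxx /= cardsU1 x_new add1n subnS.
by rewrite -subn_gt0.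
Qed.

Lemma ahead_complete_play pl k p : 0 < #|T| -> complete_play p ->
  ahead pl k p -> winning_set pl (chosen pl p).
Proof.
move=> /card_gt0P[x _] p_complete [_ p_forces]; apply: contrapT => not_won.
have no_move n O : chosen (opponent pl) p \subset O ->
    ~ forces pl n (chosen pl p) O.
  move=> sub_O /forces_move/(_ not_won)[_ [z /negP[]]].
  have : z \in chosen pl p :|: chosen (opponent pl) p.
    by rewrite chosenU inE complete_play_mem.
  exact/subsetP/setUS.
case: eqP p_forces => _ p_forces; first exact: no_move p_forces.
exact: no_move (subsetUr _ _) (p_forces x).
Qed.

Lemma forces_wins_within pl k : 0 < #|T| ->
  (forall O, #|O| <= (first != pl) -> forces pl k set0 O) ->
  wins_within e first pl k.
Proof.
move=> T_gt0 forces_start.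
have [s s_legal s_ahead] :=
  exists_legal_strategy (fun h x => ahead pl k (rcons h x)) T_gt0.
exists s => // p p_complete p_follows; apply: contrapT => never_won.
have not_won h : prefix h p -> ahead pl k h -> ~ winning_set pl (chosen pl h).
  move=> h_p [h_k _] won_h; apply: never_won.
  by exists h; rewrite has_wonE.
suff p_ahead : ahead pl k p.
  apply: (not_won p (prefix_refl p) p_ahead).
  exact: ahead_complete_play T_gt0 p_complete p_ahead.
apply: (@prefix_ind p (ahead pl k)) (prefix_refl p) => [|h x hx_p h_ahead].
  exact: ahead_nil.
have hx_uniq := prefix_uniq hx_p p_complete.1.
have h_p : prefix h p := prefix_trans (prefix_rcons h x) hx_p.
have [/eqP turn_h|turn_h] := boolP (turn (size h) == pl); last first.
  exact: ahead_opponent_move.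
have h_uniq : uniq h by move: hx_uniq; rewrite rcons_uniq => /andP[].
have [z zh z_ahead] :=
  ahead_own_move h_uniq turn_h h_ahead (not_won h h_p h_ahead).
by rewrite (p_follows h x hx_p turn_h); exact: s_ahead zh z_ahead.
Qed.

(* The danger of a block is 2 minus the number of its free vertices.  The total
   danger grows by at most one in a move of Spoiler, and Resolver brings it back
   to zero by moving in the most endangered block. *)
Section Blocks.
Variables (S : finType) (I : {set S}) (F : S -> {set T}).
Hypothesis disF : disjoint_family I F.

Definition unmet M : {set S} := [set i in I | [disjoint F i & M]].

Definition danger M O : nat := \sum_(i in unmet M) (2 - #|F i :\: O|).

Lemma unmet_setU1 M i x : x \in F i -> unmet (x |: M) \subset unmet M :\ i.
Proof.
move=> xi; apply/subsetP => j; rewrite inE => /andP[jI dis_j].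
rewrite in_setD1 inE jI (disjointWr (subsetUr _ _) dis_j) !andbT.
apply: contraTneq dis_j => ->.
by apply/negP => /disjointFr/(_ xi); rewrite setU11.
Qed.

Lemma danger_setU M O O' : danger M (O :|: O') <= danger M O + #|O'|.
Proof.
have dis_unmet : disjoint_family (unmet M) F.
  by move=> i j /setIdP[iI _] /setIdP[jI _]; exact: disF.
apply: leq_trans (leq_add (leqnn _) (sum_card_setI_le O' dis_unmet)).
rewrite -big_split; apply: leq_sum => i _ /=; rewrite -setDDl cardsD.
have : #|(F i :\: O) :&: O'| <= #|F i :&: O'|.
  by apply: subset_leq_card; rewrite setSI ?subsetDl.
lia.
Qed.

Lemma exists_most_endangered M O : unmet M != set0 -> danger M O <= 1 ->
  exists i, [/\ i \in unmet M, 0 < #|F i :\: O|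
              & {in unmet M :\ i, forall j, 1 < #|F j :\: O|}].
Proof.
case/set0Pn=> i0 i0_unmet danger_le1.
pose loss i := 2 - #|F i :\: O|.
have [i i_unmet i_max] := @arg_maxnP _ i0 (mem (unmet M)) loss i0_unmet.
have := danger_le1; rewrite /danger (big_setD1 i) //= => danger_i.
exists i; split=> // [|j j_unmet]; first lia.
move: danger_i; rewrite (big_setD1 j) //=; have := i_max j; rewrite /loss /=.
by move: j_unmet; rewrite in_setD1 => /andP[_ ->] /(_ isT); lia.
Qed.

Hypothesis meets_resolving : forall W, meets_family I F W -> resolving e W.

Lemma unmet0_resolving M : unmet M = set0 -> resolving e M.
Proof.
move=> unmet0; apply: meets_resolving => i iI; apply/negP => dis_i.
by have := in_set0 i; rewrite -unmet0 inE iI dis_i.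
Qed.

Lemma danger_forces n M O : #|unmet M| <= n -> danger M O <= 1 ->
  forces Resolver n M O.
Proof.
elim: n M O => [|n IHn] M O unmet_le danger_le1.
  by left; apply: unmet0_resolving; apply/eqP; rewrite -cards_eq0 -leqn0.
have [/unmet0_resolving|] := eqVneq (unmet M) set0; first by left.
move=> /exists_most_endangered/(_ danger_le1)[i [i_unmet]].
move=> /card_gt0P[x /setDP[xi xO]] rest_safe; have sub_unmet := unmet_setU1 M xi.
right; exists x => [|y].
  rewrite in_setU negb_or xO andbT; move: i_unmet; rewrite inE => /andP[_ dis_i].
  by rewrite (disjointFr dis_i xi).
apply: IHn.
  rewrite -ltnS; apply: leq_trans unmet_le.
  by rewrite [in leqRHS](cardsD1 i) i_unmet ltnS subset_leq_card.
rewrite (setUC _ O); apply: leq_trans (danger_setU _ _ _) _.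
rewrite cards1 addn1 ltnS leqn0 /danger big1 // => j.
by move=> /(subsetP sub_unmet)/rest_safe; rewrite -subn_eq0 => /eqP.
Qed.

Lemma resolver_wins_disjoint_blocks : 0 < #|T| ->
  \sum_(i in I) (2 - #|F i|) <= (first == Resolver) ->
  wins_within e first Resolver #|I|.
Proof.
have unmet_start : unmet set0 = I.
  by apply/setP => i; rewrite inE -setI_eq0 setI0 eqxx andbT.
move=> T_gt0 small; apply: forces_wins_within => // O O_le.
apply: danger_forces; rewrite ?unmet_start //.
rewrite -[O]set0U; apply: leq_trans (danger_setU _ _ _) _.
rewrite /danger unmet_start; under eq_bigr do rewrite setD0.
by move: small O_le; case: (first == Resolver) => /=; lia.
Qed.

End Blocks.

Definition twin_class A : Prop :=
  forall W, resolving e W -> #|A :\: W| <= 1.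

Lemma twin_class_winning A M : twin_class A -> M \subset A -> 1 < #|M| ->
  winning_set Spoiler M.
Proof.
move=> twinA sMA M_gt1 W /twinA; apply: contraTN => disWM.
rewrite -ltnNge; apply: leq_trans M_gt1 _; apply: subset_leq_card.
by rewrite subsetD sMA disjoint_sym.
Qed.

(* After any first move in A two free vertices of A are left, so that the
   opponent cannot take both. *)
Lemma twin_class_forces A O : twin_class A -> 2 < #|A :\: O| ->
  forces Spoiler 2 set0 O.
Proof.
move=> twinA A_gt2; right.
have [x xA] : exists x, x \in A :\: O by apply/card_gt0P; lia.
exists x => [|y]; first by move: xA; rewrite !inE => /andP[].
right; have [x' x'A] : exists x', x' \in A :\: O :\ x :\ y.
  apply/card_gt0P; move: A_gt2.
  by rewrite (cardsD1 x) (cardsD1 y (_ :\ x)); do 2!case: (_ \in _); lia.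
exists x' => [|y'].
  by move: x'A; rewrite !inE; case/and4P=> /negbTE-> /negbTE-> /negbTE->.
move: xA x'A; rewrite !inE => /andP[_ xA] /and4P[_ x'x _ x'A]; left.
apply: twin_class_winning twinA _ _; first by rewrite setU0 subUset !sub1set x'A.
by rewrite setU0 cards2 x'x.
Qed.

Lemma spoiler_wins_twin_class : 0 < #|T| ->
  (forall O, #|O| <= (first == Resolver) ->
     exists2 A, twin_class A & 2 < #|A :\: O|) ->
  wins_within e first Spoiler 2.
Proof.
move=> T_gt0 large_class; apply: forces_wins_within => // O O_le.
have [|A] := large_class O; last exact: twin_class_forces.
by move: O_le; case: first.
Qed.

End Plays.

(** * Distances and branches *)

Section Tree.
Variables (T : finType) (e : rel T).

Local Notation d := (dist e).
Implicit Types (a b c l m r u v w x y z : T) (W : {set T}).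

Lemma dist_le_path x p : path e x p -> d x (last x p) <= size p.
Proof.
move=> walk_p; have [lt_pT|] := ltnP (size p) #|T|; last first.
  by apply: leq_trans; rewrite -[leqRHS](size_iota 0); exact: find_size.
rewrite leqNgt; apply/negP => /(before_find 0).
rewrite nth_iota // add0n => /existsP[].
by exists (in_tuple p); rewrite walk_p eqxx.
Qed.

Hypothesis e_conn : forall x y, connect e x y.

Lemma dist_lt_card x y : d x y < #|T|.
Proof.
rewrite -[ltnRHS](size_iota 0) -has_find; apply/hasP.
have /connectP[p walk_p ->] := e_conn x y.
have [q walk_q uniq_q _] := shortenP walk_p; exists (size q).
  rewrite mem_iota /=.
  by have := max_card (mem (x :: q)); rewrite (card_uniqP uniq_q).
by apply/existsP; exists (in_tuple q); rewrite walk_q eqxx.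
Qed.

Lemma dist_path x y : exists p, [/\ path e x p, last x p = y & size p = d x y].
Proof.
have := dist_lt_card x y; rewrite -[ltnRHS](size_iota 0) -has_find.
move/(nth_find 0); rewrite nth_iota ?dist_lt_card // add0n.
by case/existsP=> p /andP[walk_p /eqP last_p]; exists p; rewrite size_tuple.
Qed.

Lemma distxx x : d x x = 0.
Proof. by apply/eqP; rewrite -leqn0; apply: (@dist_le_path x [::]). Qed.

Lemma dist_eq0 x y : (d x y == 0) = (x == y).
Proof.
apply/eqP/eqP => [d0|->]; last exact: distxx.
by case: (dist_path x y) => [[|a p] [_ //]]; rewrite d0.
Qed.

Lemma dist_triangle y x z : d x z <= d x y + d y z.
Proof.
have [p [walk_p last_p <-]] := dist_path x y.
have [q [walk_q <- <-]] := dist_path y z.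
rewrite -size_cat -{1}last_p -last_cat; apply: dist_le_path.
by rewrite cat_path walk_p last_p.
Qed.

Lemma dist_cut_vertex v x z :
  (forall p, path e x p -> last x p = z -> v \in p) -> d x z = d x v + d v z.
Proof.
move=> cut_v; apply/eqP; rewrite eqn_leq dist_triangle /=.
have [p [walk_p last_p <-]] := dist_path x z.
have vp := cut_v p walk_p last_p.
case/path.splitP: vp walk_p last_p => p1 p2.
rewrite cat_path last_cat last_rcons => /andP[walk_p1 walk_p2] <-.
rewrite size_cat; apply: leq_add; last exact: dist_le_path.
by have := dist_le_path walk_p1; rewrite last_rcons.
Qed.

Lemma resolving_compl W : #|~: W| <= 1 -> resolving e W.
Proof.
move=> compl_le1; apply/forallP => x; apply/forallP => y; apply/implyP => xy.
apply/exists_inP; have [xW|xW] := boolP (x \in W).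
  by exists x; rewrite // distxx eq_sym dist_eq0 eq_sym.
exists y; last by rewrite distxx dist_eq0.
apply: contraTT xy => yW; rewrite negbK; apply/eqP.
by apply: (card_le1_eqP compl_le1); rewrite inE.
Qed.

Lemma metric_dim_attained : exists2 W, resolving e W & #|W| = metric_dim e.
Proof.
rewrite /metric_dim; case: arg_minnP => [|W resW _]; last by exists W.
by apply: resolving_compl; rewrite setCT cards0.
Qed.

Lemma metric_dim_le W : resolving e W -> metric_dim e <= #|W|.
Proof.
rewrite /metric_dim; case: arg_minnP => [|W' _ W'_min]; last exact: W'_min.
by apply: resolving_compl; rewrite setCT cards0.
Qed.

Lemma spoiler_winning_set_gt1 W : winning_set e Spoiler W -> 1 < #|W|.
Proof.
move=> winW; rewrite ltnNge; apply/negP => W_le1.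
have /winW : resolving e (~: W) by apply: resolving_compl; rewrite setCK.
by rewrite disjoint_sym -subsets_disjoint subxx.
Qed.

Hypothesis e_sym : symmetric e.

Lemma dist_sym x y : d x y = d y x.
Proof.
have dist_ge a b : d b a <= d a b.
  have [p [walk_p <- <-]] := dist_path a b.
  have /dist_le_path : path e (last a p) (rev (belast a p)).
    by rewrite rev_path (eq_path (e' := e)) // => ? ?; exact: e_sym.
  rewrite size_rev size_belast; case: (p) => //= b' q.
  by rewrite rev_cons last_rcons.
by apply/eqP; rewrite eqn_leq !dist_ge.
Qed.

Hypothesis e_irr : irreflexive e.

Lemma dist_eq1 x y : (d x y == 1) = e x y.
Proof.
apply/eqP/idP => [|exy].
  by have [[|a [|b p]] [/= + <- <-]] // := dist_path x y; case/andP.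
apply/eqP; rewrite eqn_leq lt0n dist_eq0 (@dist_le_path x [:: y]) /= ?exy //.
by apply: contraTneq exy => ->; rewrite e_irr.
Qed.

Lemma dist_edge x y : e x y -> d x y = 1.
Proof. by rewrite -dist_eq1 => /eqP. Qed.

Lemma closer_neighbor x v : x != v -> exists2 u, e v u & d x v = (d x u).+1.
Proof.
have [p [walk_p last_p size_p]] := dist_path x v; move: walk_p last_p size_p.
case/lastP: p => [_ /= -> _|p a]; first by rewrite eqxx.
rewrite rcons_path last_rcons size_rcons => /andP[walk_p edge_a] <- size_p _.
exists (last x p); first by rewrite e_sym.
have := dist_le_path walk_p; have := dist_triangle (last x p) x a.
by rewrite (dist_edge edge_a); lia.
Qed.

(* Take the median m of x, y and z. *)
Lemma equidistant_median x y z : x != y -> d x z = d y z ->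
  exists m a b, [/\ e m a, e m b, a != b, d x a < d x m /\ d y b < d y m
                  & d x m = d y m].
Proof.
move=> xy dxyz.
pose between m := (d x z == d x m + d m z) && (d y z == d y m + d m z).
have between_z : between z by rewrite /between distxx !addn0 !eqxx.
have [m /andP[/eqP dxm /eqP dym] m_max] := arg_maxnP (fun m => d m z) between_z.
have dm : d x m = d y m by lia.
have xm : x != m.
  by apply: contraNneq xy => Ex; rewrite eq_sym -dist_eq0 Ex -dm Ex distxx.
have ym : y != m by rewrite -dist_eq0 -dm dist_eq0.
have [a ema da] := closer_neighbor xm; have [b emb db] := closer_neighbor ym.
exists m, a, b; split=> //; [|lia].
apply/eqP => Eab; rewrite -Eab in db.
have := dist_triangle a x z; have := dist_triangle a y z.
have := dist_triangle m a z; rewrite (dist_sym a m) (dist_edge ema) => *.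
suff /m_max : between a by rewrite /=; lia.
by apply/andP; split; apply/eqP; lia.
Qed.

Definition branch v u : {set T} := [set x | d x u < d x v].

Lemma branch_root v u : v \notin branch v u.
Proof. by rewrite inE distxx ltn0. Qed.

Lemma branch_neighbor v u : e v u -> u \in branch v u.
Proof. by move=> evu; rewrite inE distxx dist_sym dist_edge. Qed.

Lemma exists_branch v x : x != v -> exists2 u, e v u & x \in branch v u.
Proof. by move=> /closer_neighbor[u evu dx]; exists u; rewrite // inE dx. Qed.

Hypothesis e_acyclic : forall c : seq T, 2 < size c -> ~ ucycle e c.

Definition edge_avoiding v : rel T := [rel b c | [&& e b c, b != v & c != v]].

Lemma edge_avoiding_sym v : symmetric (edge_avoiding v).
Proof.
by move=> b c; rewrite /edge_avoiding /= e_sym; congr (_ && _); rewrite andbC.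
Qed.

Lemma neighbors_disconnected v u u' : e v u -> e v u' ->
  connect (edge_avoiding v) u u' -> u = u'.
Proof.
move=> evu evu' /connectP[p walk_p].
have [q walk_q uniq_q _ {p walk_p}] := shortenP walk_p => last_q.
apply: contrapT => uu'; apply: (@e_acyclic (v :: u :: q)).
  by case: (q) last_q uu' => // ->.
have uv : u != v by apply: contraTneq evu => ->; rewrite e_irr.
have vq : v \notin u :: q.
  elim: (q) (u) uv walk_q => [|b s IHs] a av /=; first by rewrite inE eq_sym av.
  case/andP=> /and3P[_ _ bv] /(IHs b bv).
  by rewrite (in_cons a) eq_sym (negbTE av).
have walk_e_q : path e u q by apply: sub_path walk_q => b c /andP[].
rewrite /ucycle cons_uniq vq uniq_q /= rcons_path evu walk_e_q.
by rewrite -last_q (e_sym u') evu'.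
Qed.

Lemma closer_connect v x a : a != v -> d x a <= d x v ->
  connect (edge_avoiding v) a x.
Proof.
have [n] := ubnP (d x a); elim: n a => // n IHn a lt_n av le_av.
have [->|xa] := eqVneq x a; first exact: connect0.
have [b eab db] := closer_neighbor xa.
have bv : b != v by apply: contraTneq le_av => <-; lia.
apply: connect_trans (IHn b _ bv _); [|lia|lia].
by apply: connect1; rewrite /edge_avoiding /= eab av bv.
Qed.

Lemma closer_neighbor_uniq x v u u' : e v u -> e v u' ->
  d x u <= d x v -> d x u' <= d x v -> u = u'.
Proof.
move=> evu evu' le_u le_u'; apply: neighbors_disconnected (evu) (evu') _.
have neq_v a : e v a -> a != v by apply: contraTneq => ->; rewrite e_irr.
apply: connect_trans (closer_connect (neq_v u evu) le_u) _.
rewrite (sym_connect_sym (edge_avoiding_sym v)).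
exact: closer_connect (neq_v u' evu') le_u'.
Qed.

Lemma dist_neighbor x v u : e v u ->
  d x u = (d x v).+1 \/ d x v = (d x u).+1.
Proof.
move=> evu; have [->|xv] := eqVneq x v; first by left; rewrite distxx dist_edge.
have [w evw dw] := closer_neighbor xv.
have := dist_triangle v x u; rewrite (dist_edge evu) => le_u.
have [le_uv|lt_vu] := leqP (d x u) (d x v); last by left; lia.
by right; rewrite (closer_neighbor_uniq evu evw le_uv) //; lia.
Qed.

Lemma branchE v u x : e v u -> (x \in branch v u) = (d x v == (d x u).+1).
Proof. by move=> evu; rewrite inE; have := dist_neighbor x evu; lia. Qed.

Lemma branch_disjoint v u u' x : e v u -> e v u' ->
  x \in branch v u -> x \in branch v u' -> u = u'.
Proof.
move=> evu evu'; rewrite !inE => lt_u lt_u'.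
exact: closer_neighbor_uniq evu evu' (ltnW lt_u) (ltnW lt_u').
Qed.

Lemma branch_exit v u a b : e v u -> e a b -> a \in branch v u ->
  b \notin branch v u -> b = v.
Proof.
move=> evu eab; rewrite !branchE // !(dist_sym _ u) !(dist_sym _ v).
move=> /eqP da db.
have {}db : d u b = (d v b).+1.
  by have := dist_neighbor b evu; rewrite !(dist_sym b); lia.
have dvb : d v b = d u a.
  by have := dist_neighbor v eab; have := dist_neighbor u eab; lia.
suff Eua : u = a by apply/eqP; rewrite eq_sym -dist_eq0 dvb Eua distxx.
apply: contrapT => /eqP ua; have [c eac dc] := closer_neighbor ua.
have := dist_triangle u v c; rewrite (dist_edge evu) => dvc.
have Ebc : b = c by apply: (closer_neighbor_uniq (x := v) eab eac); lia.
by rewrite -Ebc in dc; lia.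
Qed.

Lemma dist_branch v u x z : e v u -> x \in branch v u -> z \notin branch v u ->
  d x z = d x v + d v z.
Proof.
move=> evu xB zB; apply: dist_cut_vertex => p.
elim: p x xB => [|b p IHp] x xB /=; first by move=> _ xz; rewrite -xz xB in zB.
case/andP=> exb walk_p last_p; have [bB|bB] := boolP (b \in branch v u).
  by rewrite inE (IHp b) ?orbT.
by rewrite inE -(branch_exit evu exb xB bB) eqxx.
Qed.

Lemma in_branchE v u x z : e v u -> x \in branch v u ->
  (z \in branch v u) = (d x z < d x v + d v z).
Proof.
move=> evu xB; apply/idP/idP => [zB|]; last first.
  by apply: contraTT => zB; rewrite -leqNgt (dist_branch evu xB zB).
move: xB zB; rewrite !inE (dist_sym z u) (dist_sym z v).
by have := dist_triangle u x z; lia.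
Qed.

Lemma sub_branch v u w c : e v u -> e w c -> w \in branch v u ->
  v \notin branch w c -> branch w c \subset branch v u.
Proof.
move=> evu ewc wB vC; apply/subsetP => x xC; apply: contraT => xB.
have := dist_branch evu wB xB; have := dist_branch ewc xC vC.
have : d w v != 0.
  by rewrite dist_eq0; apply: contraTneq wB => ->; exact: branch_root.
by rewrite (dist_sym x v) (dist_sym x w); lia.
Qed.

Lemma branch_overlap v u w c x : e v u -> e w c -> v \notin branch w c ->
  w \notin branch v u -> x \in branch v u -> x \in branch w c -> v = w /\ u = c.
Proof.
move=> evu ewc vC wB xB xC; suff Evw : v = w.
  by split=> //; rewrite Evw in evu xB; exact: branch_disjoint evu ewc xB xC.
apply/eqP; rewrite -dist_eq0; have := dist_branch evu xB wB.
by have := dist_branch ewc xC vC; rewrite (dist_sym w v); lia.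
Qed.

Lemma deg_ge_uniq v s : uniq s -> {subset s <= nbh e v} -> size s <= deg e v.
Proof.
move=> /card_uniqP <- sub_s; exact/subset_leq_card/subsetP.
Qed.

Lemma deg_between a c x : a != x -> c != x -> d a c = d a x + d x c ->
  1 < deg e x.
Proof.
move=> ax cx dac; have [u exu du] := closer_neighbor ax.
have [w exw dw] := closer_neighbor cx.
apply/card_gt1P; exists u, w; rewrite !inE; split=> //.
apply/eqP => Euw; rewrite -Euw (dist_sym c u) (dist_sym c) in dw.
by have := dist_triangle u a c; lia.
Qed.

Lemma exists_branches_away v w : 2 < deg e w ->
  exists a b, [/\ e w a, e w b, a != b, v \notin branch w a
                  & v \notin branch w b].
Proof.
move=> deg_w; pose toward := [set c | v \in branch w c].
have toward_le1 : #|nbh e w :&: toward| <= 1.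
  apply/card_le1_eqP => c c'; rewrite !inE => /andP[ewc vc] /andP[ewc' vc'].
  by apply: (branch_disjoint ewc' ewc (x := v)); rewrite inE.
have /card_gt1P[a [b []]] : 1 < #|nbh e w :\: toward|.
  by move: deg_w; rewrite /deg -(cardsID toward (nbh e w)); lia.
by move=> /setDP[+ +] /setDP[]; rewrite !inE => *; exists a, b; rewrite !inE.
Qed.

Lemma branch_leaf v u : e v u -> exists2 l, l \in branch v u & deg e l = 1.
Proof.
move=> evu; have uB := branch_neighbor evu.
have [l lB l_max] := @arg_maxnP _ u (mem (branch v u)) (d v) uB; exists l => //.
have vl : v != l by apply: contraTneq lB => <-; exact: branch_root.
have no_farther c : e l c -> v \in branch l c.
  move=> elc; apply: contraT => vC; have cC := branch_neighbor elc.
  have /l_max := subsetP (sub_branch evu elc lB vC) _ cC.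
  rewrite /= (dist_sym v c) (dist_branch elc cC vC) (dist_sym l) (dist_sym c).
  by rewrite (dist_edge elc); lia.
apply/eqP; rewrite eqn_leq; apply/andP; split.
  apply/card_le1_eqP => a b; rewrite !inE => la lb.
  exact: branch_disjoint lb la (no_farther b lb) (no_farther a la).
by have [c elc _] := closer_neighbor vl; apply/card_gt0P; exists c; rewrite inE.
Qed.

Lemma exists_deg_le1 : T -> exists r, deg e r <= 1.
Proof.
move=> v; have [deg_v|/card_gt0P[u]] := posnP (deg e v); first by exists v; lia.
by rewrite inE => /branch_leaf[l _ deg_l]; exists l; rewrite deg_l.
Qed.

(** * Missed branches *)

Definition missed_branch W v u : bool := e v u && [disjoint W & branch v u].

Lemma dist_missed_branch W v u z : missed_branch W v u -> z \in W ->
  d u z = (d v z).+1.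
Proof.
case/andP=> evu missed_u zW; rewrite (dist_branch evu (branch_neighbor evu)).
  by rewrite (dist_sym u) (dist_edge evu).
by rewrite (disjointFr missed_u).
Qed.

Lemma resolving_missed_branch_uniq W v a b : resolving e W ->
  missed_branch W v a -> missed_branch W v b -> a = b.
Proof.
move=> resW missed_a missed_b; apply/eqP; move/forallP/(_ a)/forallP/(_ b): resW.
case: eqP => //= _ /exists_inP[z zW]; rewrite (dist_missed_branch missed_a zW).
by rewrite (dist_missed_branch missed_b zW) eqxx.
Qed.

Lemma equidistant_missed_branch W m a b x y : e m a -> e m b -> a != b ->
  x \in branch m a -> y \in branch m b -> d x m = d y m ->
  {in W, forall z, d x z = d y z} -> missed_branch W m a.
Proof.
move=> ema emb ab xa yb dm dW; rewrite /missed_branch ema.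
apply/pred0P => z; apply/negP => /= /andP[zW za].
have zb : z \notin branch m b.
  by apply: contra ab => zb; rewrite (branch_disjoint ema emb za zb).
move: za; rewrite (in_branchE _ ema xa) dW // (dist_branch emb yb zb) dm.
by rewrite ltnn.
Qed.

Lemma missed_branch_uniq_resolving W : W != set0 ->
  (forall v a b, missed_branch W v a -> missed_branch W v b -> a = b) ->
  resolving e W.
Proof.
case/set0Pn=> z0 z0W missed_uniq; apply/forallP => x; apply/forallP => y.
apply/implyP => xy; apply/exists_inP; apply: contrapT => unresolved.
have dW : {in W, forall z, d x z = d y z}.
  by move=> z zW; apply: contrapT => /eqP dz; apply: unresolved; exists z.
have [m [a [b [ema emb ab [xa yb] dm]]]] := equidistant_median xy (dW _ z0W).
have xB : x \in branch m a by rewrite inE.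
have yB : y \in branch m b by rewrite inE.
case/eqP: (ab); apply: (missed_uniq m).
  exact: equidistant_missed_branch ema emb ab xB yB dm dW.
apply: (equidistant_missed_branch emb ema _ yB xB); rewrite 1?eq_sym //.
by move=> z /dW.
Qed.

(** * Major vertices and legs *)

Lemma farther_neighbor_uniq r p x y : deg e p <= (r != p).+1 ->
  e p x -> e p y -> d r x = (d r p).+1 -> d r y = (d r p).+1 -> x = y.
Proof.
move=> deg_p epx epy dx dy; apply: contrapT => /eqP xy.
have size_le s : uniq s -> all (e p) s -> size s <= (r != p).+1.
  move=> uniq_s /allP sub_s; apply: leq_trans deg_p; apply: deg_ge_uniq => // z.
  by rewrite inE; exact: sub_s.
have [Erp|rp] := eqVneq r p.
  have := size_le [:: x; y].
  by rewrite Erp eqxx /= inE xy epx epy => /(_ isT isT).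
have [t ept dt] := closer_neighbor rp.
have tx : t != x by apply: contraPneq dx => <-; lia.
have ty : t != y by apply: contraPneq dy => <-; lia.
have := size_le [:: t; x; y].
by rewrite rp /= !inE negb_or tx ty xy ept epx epy => /(_ isT isT).
Qed.

Lemma level_uniq r n : deg e r <= 1 ->
  (forall z, d r z < n -> ~~ major e z) ->
  forall x y, d r x = d r y -> d r x <= n -> x = y.
Proof.
move=> deg_r nonmajor x; have [k] := ubnP (d r x).
elim: k x => // k IHk x lt_k y dxy le_n.
have [Erx|rx] := eqVneq r x.
  by apply/eqP; move/eqP: dxy; rewrite -Erx distxx eq_sym dist_eq0.
have ry : r != y by rewrite -dist_eq0 -dxy dist_eq0.
have [p exp dp] := closer_neighbor rx; have [q eyq dq] := closer_neighbor ry.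
have Epq : p = q by apply: IHk; lia.
rewrite -{q}Epq in eyq dq.
apply: (@farther_neighbor_uniq r p); rewrite ?[e p _]e_sym //.
by case: eqVneq => [<- //|_]; rewrite leqNgt; apply: nonmajor; lia.
Qed.

Lemma dist_through_level r x y : deg e r <= 1 ->
  (forall z, d r z < d r x -> ~~ major e z) ->
  d r x <= d r y -> d r y = d r x + d x y.
Proof.
move=> deg_r nonmajor; have [k] := ubnP (d r y).
elim: k y => // k IHk y lt_k le_xy.
have [dxy|lt_xy] := eqVneq (d r x) (d r y).
  by rewrite (level_uniq deg_r nonmajor dxy) ?distxx ?addn0.
have ry : r != y by rewrite -dist_eq0; lia.
have [q eyq dq] := closer_neighbor ry.
have dxq : d r q = d r x + d x q by apply: IHk; lia.
have := dist_triangle q x y; have := dist_triangle x r y.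
by rewrite (dist_sym q y) (dist_edge eyq); lia.
Qed.

Lemma dist_inj_path_graph r : injective (d r) -> is_path_graph e.
Proof.
move=> dist_inj; pose g x : 'I_#|T| := Ordinal (dist_lt_card r x).
have g_inj : injective g by move=> x y /(congr1 val) /dist_inj.
have [|f gK fK] := inj_card_bij g_inj; first by rewrite card_ord.
exists #|T|, f; split; first by exists g.
suff edgeE x y : e x y = ((d r x).+1 == d r y) || ((d r y).+1 == d r x).
  by move=> i j; rewrite edgeE -[in RHS](fK i) -[in RHS](fK j).
have step_edge x' y' : (d r x').+1 = d r y' -> e y' x'.
  move=> dy; have ry : r != y' by rewrite -dist_eq0 -dy.
  have [q eyq dq] := closer_neighbor ry.
  by rewrite (dist_inj x' q) //; lia.
apply/idP/orP => [exy|[]/eqP/step_edge //]; last by rewrite e_sym.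
by have [dy|dy] := dist_neighbor r exy; [left|right]; rewrite dy.
Qed.

Lemma exists_major : ~ is_path_graph e -> T -> exists v, major e v.
Proof.
move=> npath v; apply: contrapT => nmajor.
have [r deg_r] := exists_deg_le1 v.
apply/npath/(@dist_inj_path_graph r) => x y dxy.
apply: (level_uniq (n := d r x) deg_r) dxy _ => // z _.
by apply/negP => z_major; apply: nmajor; exists z.
Qed.

Lemma terminalP l v : reflect
  [/\ deg e l = 1, major e v & forall w, major e w -> w != v -> d l v < d l w]
  (terminal e l v).
Proof.
apply: (iffP and3P) => -[].
  move=> /eqP deg_l v_major /forallP near; split=> // w w_major wv.
  by move: (near w); rewrite w_major wv.
move=> /eqP deg_l v_major near; split=> //; apply/forallP => w; apply/implyP.
by case/andP; exact: near.
Qed.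

Lemma terminal_uniq l v w : terminal e l v -> terminal e l w -> v = w.
Proof.
case/terminalP=> _ v_major near_v /terminalP[_ w_major near_w].
apply: contrapT => /eqP vw; have := near_w v v_major vw.
by have := near_v w w_major; rewrite eq_sym vw => /(_ isT); lia.
Qed.

(* For l terminal at v this is the path from l to v without v. *)
Definition leg l v : {set T} := [set x | d l x < d l v].

Section Leg.
Variables l v : T.
Hypothesis terminal_lv : terminal e l v.

Lemma leg_not_major x : x \in leg l v -> ~~ major e x.
Proof.
case/terminalP: terminal_lv => _ _ near; rewrite inE; apply: contraTN => x_major.
by rewrite -leqNgt; have [->//|/(near x x_major)/ltnW] := eqVneq x v.
Qed.

Lemma terminal_neq : l != v.
Proof.
case/terminalP: terminal_lv => deg_l + _; rewrite /major.
by apply: contraTneq => <-; rewrite deg_l.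
Qed.

Lemma leaf_in_leg : l \in leg l v.
Proof. by rewrite inE distxx lt0n dist_eq0 terminal_neq. Qed.

Lemma dist_through_leg x y : d l x <= d l v -> d l x <= d l y ->
  d l y = d l x + d x y.
Proof.
case/terminalP: terminal_lv => deg_l _ _ dx.
apply: dist_through_level; first by rewrite deg_l.
by move=> z dz; apply: leg_not_major; rewrite inE; lia.
Qed.

Lemma leg_branch : exists2 u, e v u & leg l v = branch v u.
Proof.
have [u evu du] := closer_neighbor terminal_neq; exists u => //.
have lB : l \in branch v u by rewrite inE du.
apply/setP => x; rewrite (in_branchE _ evu lB).
apply/idP/idP => [|dx]; first by rewrite inE; lia.
rewrite inE ltnNge; apply/negP => le_vx.
by rewrite (dist_through_leg (leqnn _) le_vx) ltnn in dx.
Qed.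

Lemma leg_leaf x : x \in leg l v -> deg e x = 1 -> x = l.
Proof.
move=> xl deg_x; apply/eqP; apply: contraT; rewrite eq_sym => lx.
have vx : v != x by apply: contraTneq xl => <-; rewrite inE ltnn.
suff : 1 < deg e x by rewrite deg_x.
rewrite inE in xl; apply: deg_between lx vx _.
exact: dist_through_leg (ltnW xl) (ltnW xl).
Qed.

Lemma leg_adjacent : e v l -> leg l v = [set l].
Proof.
move=> evl; apply/setP => x; rewrite !inE (dist_sym l v) (dist_edge evl).
by rewrite ltnS leqn0 dist_eq0 eq_sym.
Qed.

Lemma leg_card_gt1 : ~~ e v l -> 1 < #|leg l v|.
Proof.
move=> nvl; have [u evu legE] := leg_branch.
apply/card_gt1P; exists l, u; split; first exact: leaf_in_leg.
  by rewrite legE branch_neighbor.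
by apply: contraNneq nvl => ->.
Qed.

End Leg.

Lemma leg_overlap l l' v v' x : terminal e l v -> terminal e l' v' ->
  x \in leg l v -> x \in leg l' v' -> l = l'.
Proof.
move=> term_l term_l'; have [u evu legE] := leg_branch term_l.
have [u' evu' legE'] := leg_branch term_l' => xl xl'.
have v_l' : v \notin leg l' v'.
  by apply/negP => /(leg_not_major term_l'); case/terminalP: term_l => _ ->.
have v'_l : v' \notin leg l v.
  by apply/negP => /(leg_not_major term_l); case/terminalP: term_l' => _ ->.
rewrite legE in v'_l xl; rewrite legE' in v_l' xl'.
have [Ev Eu] := branch_overlap evu evu' v_l' v'_l xl xl'.
apply: (leg_leaf term_l'); last by case/terminalP: term_l.
by rewrite legE' -Ev -Eu -legE leaf_in_leg.
Qed.

Lemma branch_leg v u : e v u -> major e v ->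
  {in branch v u, forall w, ~~ major e w} ->
  exists2 l, terminal e l v & leg l v = branch v u.
Proof.
move=> evu v_major nonmajor; have [l lB deg_l] := branch_leaf evu.
have term_l : terminal e l v.
  apply/terminalP; split=> // w w_major wv.
  have wB : w \notin branch v u by apply: contraL w_major => /nonmajor.
  rewrite (dist_branch evu lB wB) -[ltnLHS]addn0 ltn_add2l lt0n dist_eq0.
  by rewrite eq_sym.
exists l => //; have [u' evu' legE] := leg_branch term_l.
have -> // : u = u'; apply: branch_disjoint evu evu' lB _.
by rewrite -legE leaf_in_leg.
Qed.

(** * Missed legs *)

Definition missed_leg W v l : bool := terminal e l v && [disjoint W & leg l v].

Lemma resolving_missed_leg_uniq W v l l' : resolving e W ->
  missed_leg W v l -> missed_leg W v l' -> l = l'.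
Proof.
move=> resW /andP[term_l missed_l] /andP[term_l' missed_l'].
have [u evu legE] := leg_branch term_l.
have [u' evu' legE'] := leg_branch term_l'.
have Eu : u = u'.
  by apply: (resolving_missed_branch_uniq (v := v) resW);
    rewrite /missed_branch ?evu ?evu' -?legE -?legE'.
apply: (leg_overlap (x := l)) (term_l) (term_l') (leaf_in_leg term_l) _.
by rewrite legE' -Eu -legE leaf_in_leg.
Qed.

Hypothesis e_major : exists v, major e v.

Section MissedLegs.
Variable W : {set T}.
Hypothesis missed_leg_uniq :
  forall v l l', missed_leg W v l -> missed_leg W v l' -> l = l'.

Lemma nonmajor_missed_branch_uniq v a b : major e v ->
  {in branch v a, forall w, ~~ major e w} ->
  {in branch v b, forall w, ~~ major e w} ->
  missed_branch W v a -> missed_branch W v b -> a = b.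
Proof.
move=> v_major nonmajor_a nonmajor_b /andP[eva missed_a] /andP[evb missed_b].
have [l term_l legE] := branch_leg eva v_major nonmajor_a.
have [l' term_l' legE'] := branch_leg evb v_major nonmajor_b.
have Ell' : l = l'.
  by apply: (missed_leg_uniq (v := v));
    rewrite /missed_leg ?term_l ?term_l' ?legE ?legE'.
apply: branch_disjoint eva evb (_ : l \in _) _.
  by rewrite -legE leaf_in_leg.
by rewrite -legE' Ell' leaf_in_leg.
Qed.

(* Two branches at the major vertex of the branch farthest from v, leading away
   from v, would be missed legs. *)
Lemma missed_branch_not_major v u w :
  missed_branch W v u -> w \in branch v u -> ~~ major e w.
Proof.
case/andP=> evu missed_u wB; apply/negP => w_major.
have w_in : (w \in branch v u) && major e w by rewrite wB.
have [m /andP[mB m_major] m_max] :=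
  @arg_maxnP _ w [pred x | (x \in branch v u) && major e x] (d v) w_in.
have [a [b [ema emb ab va vb]]] := exists_branches_away v m_major.
have missed c : e m c -> v \notin branch m c ->
    missed_branch W m c /\ {in branch m c, forall x, ~~ major e x}.
  move=> emc vc; have sub_c := sub_branch evu emc mB vc.
  split=> [|x xc]; first by rewrite /missed_branch emc (disjointWr sub_c).
  apply/negP => x_major; have := m_max x; rewrite /= (subsetP sub_c) // x_major.
  move=> /(_ isT); rewrite (dist_sym v x) (dist_branch emc xc vc) (dist_sym v m).
  rewrite -[leqRHS]add0n leq_add2r leqn0 dist_eq0 => /eqP Exm.
  by rewrite Exm (negbTE (branch_root m c)) in xc.
have [[missed_a nonmajor_a] [missed_b nonmajor_b]] :=
  (missed a ema va, missed b emb vb).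
case/eqP: ab; exact: nonmajor_missed_branch_uniq missed_a missed_b.
Qed.

Lemma missed_leg_uniq_missed_branch_uniq m a b :
  missed_branch W m a -> missed_branch W m b -> a = b.
Proof.
move=> missed_a missed_b; have [m_major|m_minor] := boolP (major e m).
  apply: (@nonmajor_missed_branch_uniq m) => // w.
    exact: missed_branch_not_major.
  exact: missed_branch_not_major.
have [w w_major] := e_major.
have wm : w != m by apply: contraNneq m_minor => <-.
have [c emc wc] := exists_branch wm.
have c_neq u : missed_branch W m u -> c != u.
  by apply: contraTneq => <-; apply/negP => /missed_branch_not_major/(_ wc)/negP.
apply: contrapT => /eqP ab; case/negP: m_minor.
apply: (@deg_ge_uniq m [:: c; a; b]).
  by rewrite /= !inE negb_or ab !c_neq.
case/andP: missed_a => ema _; case/andP: missed_b => emb _.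
by move=> u; rewrite !inE => /or3P[] /eqP->.
Qed.

Lemma missed_leg_uniq_resolving : resolving e W.
Proof.
apply: missed_branch_uniq_resolving missed_leg_uniq_missed_branch_uniq.
apply/eqP => W0; have [w /ltnW/card_gt1P[a [b []]]] := e_major.
rewrite !inE => ewa ewb /eqP; apply.
by apply: (@missed_leg_uniq_missed_branch_uniq w);
  rewrite /missed_branch W0 ?ewa ?ewb -setI_eq0 set0I eqxx.
Qed.

End MissedLegs.

(** * Leaves and the metric dimension *)

Definition leaves : {set T} := [set l | deg e l == 1].

Lemma exists_terminal l : l \in leaves -> exists v, terminal e l v.
Proof.
rewrite inE => /eqP deg_l; have [w w_major] := e_major.
have [v v_major v_min] := @arg_minnP _ w (major e) (d l) w_major.
exists v; apply/terminalP; split=> // z z_major zv.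
rewrite ltn_neqAle v_min // andbT; apply: contraNneq zv => dvz.
apply/eqP/esym/(level_uniq (r := l) (n := d l v)) => // [|x].
  by rewrite deg_l.
by rewrite ltnNge; apply: contra => /v_min.
Qed.

(* The junk value l is taken only when l is not a leaf. *)
Definition top l : T := odflt l [pick v | terminal e l v].

Lemma top_terminal l : l \in leaves -> terminal e l (top l).
Proof.
move=> /exists_terminal[v term_l]; rewrite /top; case: pickP => //= /(_ v).
by rewrite term_l.
Qed.

Lemma terminal_leaf l v : terminal e l v -> l \in leaves.
Proof. by case/terminalP=> deg_l _ _; rewrite inE deg_l. Qed.

Lemma terminal_top l v : terminal e l v -> top l = v.
Proof.
move=> term_l; apply: (terminal_uniq _ term_l).
exact: top_terminal (terminal_leaf term_l).
Qed.

Lemma terminal_ext_major l v : terminal e l v -> v \in ext_major e.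
Proof.
move=> term_l; rewrite inE; case/terminalP: (term_l) => _ -> _ /=.
by apply/card_gt0P; exists l; rewrite inE.
Qed.

Lemma leg_disjoint : disjoint_family leaves (fun l => leg l (top l)).
Proof.
by move=> l l' /top_terminal term_l /top_terminal term_l' x; exact: leg_overlap.
Qed.

Lemma resolving_card_ge W : resolving e W -> leaf_num e - ex_num e <= #|W|.
Proof.
move=> resW; pose missed := [set l | missed_leg W (top l) l].
have le_missed : #|leaves :&: missed| <= ex_num e.
  rewrite -(@card_in_imset _ _ top) => [|l l'].
    apply/subset_leq_card/subsetP => _ /imsetP[l /setIP[lL _] ->].
    exact: terminal_ext_major (top_terminal lL).
  rewrite !inE => /andP[_ missed_l] /andP[_ missed_l'] Etop.
  rewrite -Etop in missed_l'.
  exact: resolving_missed_leg_uniq missed_l missed_l'.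
have le_met : #|leaves :\: missed| <= #|W|.
  have dis_met : disjoint_family (leaves :\: missed) (fun l => leg l (top l)).
    by move=> l l' /setDP[lL _] /setDP[l'L _]; exact: leg_disjoint.
  apply: leq_trans (sum_card_setI_le W dis_met); rewrite -sum1_card.
  apply: leq_sum => l /setDP[lL]; rewrite inE /missed_leg (top_terminal lL) /=.
  by rewrite -setI_eq0 setIC card_gt0.
by rewrite leq_subLR -[leaf_num e]/#|leaves| -(cardsID missed); exact: leq_add.
Qed.

Definition pendants v : {set T} := nbh e v :&: term_set e v.

Lemma pendantsE v l : (l \in pendants v) = e v l && terminal e l v.
Proof. by rewrite !inE. Qed.

(* A pendant is preferred because its leg has only one vertex; v is a junk
   value. *)
Definition spare v : T :=
  if [pick l in pendants v] is Some l then l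
  else odflt v [pick l in term_set e v].

Lemma spare_terminal v : v \in ext_major e -> terminal e (spare v) v.
Proof.
rewrite inE /spare => /andP[_ /card_gt0P[l lv]].
case: pickP => [x|_]; first by rewrite pendantsE => /andP[].
by case: pickP => [x|/(_ l)]; [rewrite inE | rewrite lv].
Qed.

Lemma spare_pendant v : pendants v != set0 -> spare v \in pendants v.
Proof.
by case/set0Pn=> l lv; rewrite /spare; case: pickP => // /(_ l); rewrite lv.
Qed.

Definition unspared : {set T} := leaves :\: spare @: ext_major e.

Lemma card_unspared : #|unspared| = leaf_num e - ex_num e.
Proof.
rewrite cardsD; congr (_ - _).
have /setIidPr -> : spare @: ext_major e \subset leaves.
  by apply/subsetP => _ /imsetP[v /spare_terminal/terminal_leaf ? ->].
apply: card_in_imset => v w /spare_terminal term_v /spare_terminal term_w Es.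
by rewrite Es in term_v; exact: terminal_uniq term_v term_w.
Qed.

Lemma in_unspared l v : terminal e l v -> (l \in unspared) = (l != spare v).
Proof.
move=> term_l; rewrite inE (terminal_leaf term_l) andbT; congr (~~ _).
apply/imsetP/eqP => [[w /spare_terminal term_w El]|->].
  by rewrite -El in term_w; rewrite -(terminal_uniq term_w term_l).
by exists v; rewrite // (terminal_ext_major term_l).
Qed.

Lemma unspared_resolving : resolving e unspared.
Proof.
apply: missed_leg_uniq_resolving => v l l'.
suff missed_spare l0 : missed_leg unspared v l0 -> l0 = spare v.
  by move=> /missed_spare -> /missed_spare ->.
case/andP=> term_l missed; apply/eqP; rewrite -[_ == _]negbK.
by rewrite -(in_unspared term_l) (disjointFl missed) ?leaf_in_leg.
Qed.

Lemma metric_dim_tree : metric_dim e = leaf_num e - ex_num e.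
Proof.
apply/eqP; rewrite eqn_leq; apply/andP; split.
  by rewrite -card_unspared; exact: metric_dim_le unspared_resolving.
by have [W resW <-] := metric_dim_attained; exact: resolving_card_ge.
Qed.

(** * The surplus of pendants *)

Lemma pendants_twin_class v : twin_class e (pendants v).
Proof.
move=> W resW; apply/card_le1_eqP => l l' /setDP[+ lW] /setDP[+ l'W].
rewrite !pendantsE => /andP[evl term_l] /andP[evl' term_l'].
by apply: (resolving_missed_leg_uniq (v := v) resW);
  rewrite /missed_leg ?term_l ?term_l' leg_adjacent // disjoint_sym disjoints1.
Qed.

Lemma pendants_disjoint : disjoint_family setT pendants.
Proof.
move=> v w _ _ l; rewrite !pendantsE => /andP[_ term_v] /andP[_ term_w].
exact: terminal_uniq term_v term_w.
Qed.

Lemma tree_nonempty : 0 < #|T|.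
Proof. by have [v _] := e_major; apply/card_gt0P; exists v. Qed.

Definition surplus : nat := \sum_v (#|pendants v| - 2).

Lemma surplus_spoiler_wins (first : player) :
  (first == Resolver) < surplus -> wins_within e first Spoiler 2.
Proof.
move=> surplus_gt; apply: spoiler_wins_twin_class tree_nonempty _ => O O_le.
suff [v v_gt2] : exists v, 2 < #|pendants v :\: O|.
  by exists (pendants v) => //; exact: pendants_twin_class.
apply: contrapT => no_v; move: surplus_gt; apply/negP; rewrite -leqNgt.
apply: leq_trans O_le; apply: leq_trans (sum_card_setI_le O pendants_disjoint).
rewrite [leqRHS](eq_bigl xpredT) => [|v]; last exact: in_setT.
apply: leq_sum => v _; rewrite leq_subLR -(cardsID O) addnC leq_add2r leqNgt.
by apply/negP => v_gt2; apply: no_v; exists v.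
Qed.

(* v is a junk value, taken unless there is a second pendant at v. *)
Definition mate v : T := odflt v [pick l in pendants v :\ spare v].

Lemma mate_pendant v : pendants v :\ spare v != set0 ->
  mate v \in pendants v :\ spare v.
Proof.
by case/set0Pn=> l lv; rewrite /mate; case: pickP => // /(_ l); rewrite lv.
Qed.

Lemma card_pendants_spare_mate v :
  #|pendants v :\ spare v :\ mate v| = #|pendants v| - 2.
Proof.
have [->|/spare_pendant spare_v] := eqVneq (pendants v) set0.
  by rewrite !set0D cards0.
rewrite (cardsD1 (spare v) (pendants v)) spare_v.
have [->|/mate_pendant mate_v] := eqVneq (pendants v :\ spare v) set0.
  by rewrite !set0D cards0.
by rewrite (cardsD1 (mate v) (pendants v :\ spare v)) mate_v; lia.
Qed.

(* Resolver may miss one of the legs of spare v and mate v, so that these form a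
   single block. *)
Definition merged l : T := if l == spare (top l) then mate (top l) else l.

Definition block i : {set T} :=
  \bigcup_(l in term_set e (top i) | merged l == i) leg l (top i).

Lemma block_disjoint : disjoint_family unspared block.
Proof.
move=> i j _ _ x /bigcupP[l /andP[term_l /eqP l_i] xl].
case/bigcupP=> l' /andP[term_l' /eqP l'_j] xl'; rewrite !inE in term_l term_l'.
by rewrite -l_i -l'_j (leg_overlap term_l term_l' xl xl').
Qed.

Lemma unspared_terminal i : i \in unspared -> terminal e i (top i).
Proof. by case/setDP=> /top_terminal. Qed.

Lemma unspared_neq_spare i : i \in unspared -> i != spare (top i).
Proof. by move=> iU; rewrite -(in_unspared (unspared_terminal iU)). Qed.

Lemma leg_sub_block i : i \in unspared -> leg i (top i) \subset block i.
Proof.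
move=> iU; apply: (bigcup_sup i).
by rewrite inE unspared_terminal //= /merged (negbTE (unspared_neq_spare iU)).
Qed.

Lemma spare_leg_sub_block i : i \in unspared -> i = mate (top i) ->
  leg (spare (top i)) (top i) \subset block i.
Proof.
move=> /unspared_terminal/terminal_ext_major/spare_terminal term_spare i_mate.
apply: (bigcup_sup (spare (top i))).
by rewrite inE term_spare /merged (terminal_top term_spare) eqxx -i_mate eqxx.
Qed.

Lemma missed_leg_mate W v l :
  meets_family unspared block W -> missed_leg W v l -> l != spare v ->
  l = mate v /\ ~~ missed_leg W v (spare v).
Proof.
move=> meets /andP[term_l missed]; rewrite -(in_unspared term_l) => /meets.
case/pred0Pn=> z /= /andP[/bigcupP[l' /andP[+ +] +] zW].
rewrite (terminal_top term_l) inE /merged => term_l'.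
rewrite (terminal_top term_l').
case: (eqVneq l' (spare v)) => [-> /eqP<- z_spare|_ /eqP-> zl].
  by split=> //; apply/negP => /andP[_ /disjointFr/(_ zW)]; rewrite z_spare.
by rewrite (disjointFr missed zW) in zl.
Qed.

Lemma meets_blocks_resolving W :
  meets_family unspared block W -> resolving e W.
Proof.
move=> meets; apply: missed_leg_uniq_resolving => v l l' missed_l missed_l'.
have [El|/(missed_leg_mate meets missed_l)[-> not_spare]] := eqVneq l (spare v);
have [El'|/(missed_leg_mate meets missed_l')[-> not_spare']] :=
  eqVneq l' (spare v) => //.
- by rewrite El El'.
- by rewrite -El missed_l in not_spare'.
- by rewrite -El' missed_l' in not_spare.
Qed.

Lemma block_deficit_le i : i \in unspared ->
  2 - #|block i| <= (i \in pendants (top i) :\ spare (top i) :\ mate (top i)).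
Proof.
move=> iU; have term_i := unspared_terminal iU.
have ib : i \in block i := subsetP (leg_sub_block iU) i (leaf_in_leg term_i).
have block_gt0 : 0 < #|block i| by apply/card_gt0P; exists i.
rewrite !in_setD1 (unspared_neq_spare iU) pendantsE term_i andbT /=.
have [i_mate|_] := eqVneq i (mate (top i)).
  suff : 1 < #|block i| by lia.
  apply/card_gt1P; exists i, (spare (top i)); split=> //; last first.
    exact: unspared_neq_spare.
  apply: (subsetP (spare_leg_sub_block iU i_mate)); apply: leaf_in_leg.
  exact: spare_terminal (terminal_ext_major term_i).
have [_|/(leg_card_gt1 term_i) leg_gt1] := boolP (e (top i) i).
  by rewrite /=; lia.
by have := subset_leq_card (leg_sub_block iU); rewrite /=; lia.
Qed.

Lemma sum_block_deficit_le : \sum_(i in unspared) (2 - #|block i|) <= surplus.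
Proof.
rewrite (partition_big top predT) //=; apply: leq_sum => v _.
rewrite -card_pendants_spare_mate -sum1_card big_mkcond [leqRHS]big_mkcond /=.
apply: leq_sum => i _; case: andP => // -[i_unspared /eqP <-].
exact: block_deficit_le.
Qed.

Lemma surplus_resolver_wins (first : player) : surplus <= (first == Resolver) ->
  wins_within e first Resolver (leaf_num e - ex_num e).
Proof.
move=> surplus_le; rewrite -card_unspared.
apply: (resolver_wins_disjoint_blocks block_disjoint) => //.
- exact: meets_blocks_resolving.
- exact: tree_nonempty.
exact: leq_trans sum_block_deficit_le surplus_le.
Qed.

Lemma pendants_ext_major2 v : 1 < #|pendants v| -> v \in ext_major2 e.
Proof.
move=> v_gt1; have /card_gt0P[l] := ltnW v_gt1.
rewrite pendantsE => /andP[_ term_l].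
rewrite inE (terminal_ext_major term_l) (leq_trans v_gt1) //.
by apply: subset_leq_card; exact: subsetIr.
Qed.

Lemma pendants_excess_eq0 v : (v \in ext_major2 e -> #|pendants v| <= 2) ->
  #|pendants v| - 2 = 0.
Proof.
move=> v_le2; apply/eqP; rewrite subn_eq0 leqNgt; apply/negP => v_gt2.
by have := v_le2 (pendants_ext_major2 (ltnW v_gt2)); rewrite leqNgt v_gt2.
Qed.

Lemma surplus_eq0 :
  {in ext_major2 e, forall v, #|pendants v| <= 2} -> surplus = 0.
Proof.
move=> pendants_le2; apply: big1 => v _.
exact/pendants_excess_eq0/pendants_le2.
Qed.

Lemma surplus_eq_excess w :
  {in ext_major2 e, forall v, v <> w -> #|pendants v| <= 2} ->
  surplus = #|pendants w| - 2.
Proof.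
move=> pendants_le2; rewrite /surplus (bigD1 w) //= big1 ?addn0 // => v /eqP vw.
by apply: pendants_excess_eq0 => v_ext; exact: pendants_le2.
Qed.

Lemma surplus_ge_excess v : #|pendants v| - 2 <= surplus.
Proof. by rewrite /surplus (bigD1 v) //= leq_addr. Qed.

Lemma surplus_ge_pair u w : u <> w ->
  (#|pendants u| - 2) + (#|pendants w| - 2) <= surplus.
Proof.
move=> /eqP uw; rewrite /surplus (bigD1 u) //= (bigD1 w) 1?eq_sym //=.
by rewrite addnA leq_addr.
Qed.

Lemma resolver_has_winning_strategy (first : player) :
  has_winning_strategy e first Resolver <-> surplus <= (first == Resolver).
Proof.
split=> [R_wins|/surplus_resolver_wins/wins_within_has_winning_strategy //].
rewrite leqNgt; apply/negP => /surplus_spoiler_wins S_wins.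
apply: winning_strategy_exclusive R_wins _.
exact: wins_within_has_winning_strategy S_wins.
Qed.

Lemma spoiler_has_winning_strategy (first : player) :
  has_winning_strategy e first Spoiler <-> (first == Resolver) < surplus.
Proof.
split=> [S_wins|/surplus_spoiler_wins/wins_within_has_winning_strategy //].
rewrite ltnNge; apply/negP => /resolver_has_winning_strategy R_wins.
exact: winning_strategy_exclusive R_wins S_wins.
Qed.

Lemma resolver_moves_to_win (first : player) :
  has_winning_strategy e first Resolver ->
  moves_to_win e first Resolver = Some (metric_dim e).
Proof.
move=> /resolver_has_winning_strategy/surplus_resolver_wins.
by rewrite -metric_dim_tree => /moves_to_win_eq; apply; exact: metric_dim_le.
Qed.

Lemma spoiler_moves_to_win (first : player) :
  has_winning_strategy e first Spoiler ->
  moves_to_win e first Spoiler = Some 2.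
Proof.
move=> /spoiler_has_winning_strategy/surplus_spoiler_wins/moves_to_win_eq.
by apply; exact: spoiler_winning_set_gt1.
Qed.

End Tree.

Theorem theorem4p3 (T : finType) (e : rel T)
    (tree_e : is_tree e) (npath_e : ~ is_path_graph e) :
  [/\ ((exists2 v, v \in ext_major2 e & 4 <= #|nbh e v :&: term_set e v|) \/
       (exists u w, [/\ u \in ext_major2 e, w \in ext_major2 e, u <> w,
                        #|nbh e u :&: term_set e u| = 3
                      & #|nbh e w :&: term_set e w| = 3])) ->
      has_outcome e OutcomeS,
      (exists w, [/\ w \in ext_major2 e, #|nbh e w :&: term_set e w| = 3
                   & forall v, v \in ext_major2 e -> v <> w ->
                       #|nbh e v :&: term_set e v| <= 2]) ->
      has_outcome e OutcomeN,
      (forall v, v \in ext_major2 e -> #|nbh e v :&: term_set e v| <= 2) ->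
      has_outcome e OutcomeR,
      has_outcome e OutcomeS -> S_MB e = Some 2 /\ S_MB' e = Some 2
    & has_outcome e OutcomeR ->
      [/\ R_MB e = Some (metric_dim e), R_MB' e = Some (metric_dim e)
        & metric_dim e = leaf_num e - ex_num e]].
Proof.
case: (tree_e) => e_sym e_irr T_gt0 e_conn e_acyclic.
have e_major : exists v, major e v.
  by have /card_gt0P[v _] := T_gt0; exact: exists_major npath_e v.
split.
- move=> many; suff surplus_gt1 : 1 < surplus e.
    by split; apply/spoiler_has_winning_strategy => //; exact: ltnW.
  case: many => [[v _ pendants_v]|[u [w [_ _ uw pendants_u pendants_w]]]].
    by apply: (leq_trans _ (surplus_ge_excess e v)); rewrite /pendants; lia.
  apply: (leq_trans _ (surplus_ge_pair e uw)).
  by rewrite /pendants pendants_u pendants_w.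
- move=> [w [_ pendants_w /surplus_eq_excess]].
  rewrite /pendants pendants_w => surplus1.
  by split; [apply/resolver_has_winning_strategy
            |apply/spoiler_has_winning_strategy]; rewrite ?surplus1.
- move=> /surplus_eq0 surplus0.
  by split; apply/resolver_has_winning_strategy; rewrite ?surplus0.
- by move=> [S_wins S_wins']; split; exact: spoiler_moves_to_win.
- move=> [R_wins R_wins']; split; [| |exact: metric_dim_tree].
    exact: resolver_moves_to_win.
  exact: resolver_moves_to_win.
Qed.
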